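(* Let $n\geq 9$ be an integer and let $T$ be a connected graph of order $n$ (in particular, $T$ may be any tree of order $n$). Then $Z_1(T)\geq Z_1(K_{1,n-1})$, with equality if and only if $T$ is (isomorphic to) the star $K_{1,n-1}$.
   Context: All graphs are finite, simple and undirected. The order of a graph is its number of vertices. For a graph $G$, a $1$-nearly independent edge subset of $G$ is a subset $I\subseteq E(G)$ that contains exactly one (unordered) pair of adjacent edges, i.e. exactly one pair of distinct edges of $I$ share a common end-vertex. $Z_1(G)$ denotes the number of $1$-nearly independent edge subsets of $G$. $K_{1,n-1}$ is the star with $n$ vertices. *)

(* Defs.v *)
From mathcomp Require Import all_boot.

Set Implicit Arguments.
Unset Strict Implicit.
Unset Printing Implicit Defensive.

Record sgraph := SGraph {
  vertex :> finType;
  adj : rel vertex;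
  adj_sym : symmetric adj;
  adj_irrefl : irreflexive adj
}.

Arguments adj {s}.

(* The empty graph counts as connected here. *)
Definition connected (G : sgraph) : Prop :=
  forall x y : G, connect adj x y.

Definition isomorphic (G H : sgraph) : Prop :=
  exists2 f : G -> H, bijective f & forall x y : G, adj (f x) (f y) = adj x y.

Section EdgeSubsets.
Variable G : sgraph.

Definition edges : {set {set G}} :=
  [set e | [exists x : G, exists y : G, adj x y && (e == [set x; y])]].

Definition adjacent_edges (e f : {set G}) : bool :=
  (e != f) && (e :&: f != set0).

(* Unordered pairs, each represented by the two-element set [set e; f]. *)
Definition adjacent_pairs (I : {set {set G}}) : {set {set {set G}}} :=
  [set p | [exists e in I, exists f in I,
              adjacent_edges e f && (p == [set e; f])]].

Definition nearly_independent1 (I : {set {set G}}) : bool :=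
  (I \subset edges) && (#|adjacent_pairs I| == 1).

Definition Z1 : nat := #|[set I : {set {set G}} | nearly_independent1 I]|.

End EdgeSubsets.

Section CompleteBipartite.
Variables a b : nat.

Definition is_left (u : 'I_a + 'I_b) : bool := if u is inl _ then true else false.

Definition biadj : rel ('I_a + 'I_b) := fun u v => is_left u != is_left v.

Lemma biadj_sym : symmetric biadj.
Proof. by move=> u v; rewrite /biadj eq_sym. Qed.

Lemma biadj_irrefl : irreflexive biadj.
Proof. by move=> u; rewrite /biadj eqxx. Qed.

Definition complete_bipartite : sgraph := SGraph biadj_sym biadj_irrefl.

End CompleteBipartite.

(* The star of order n, for n >= 1; star 0 is star 1. *)
Definition star (n : nat) : sgraph := complete_bipartite 1 n.-1.

(* Main.v *)
Require Import Defs.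
From mathcomp Require Import all_boot perm zify.

(** Counting by size shows why the bound holds.  Write z(F) for the number of
    subsets of an edge set F with exactly one adjacent pair.  In a star with m
    edges all pairs of edges are adjacent, so z = 'C(m, 2).  As z is monotone in
    F, it is enough to bound it on a spanning tree, grown one leaf at a time from
    a single vertex.

    Let the next leaf edge be e = uv, attached at u, to a tree with edge set F,
    m = #|F|.  Let K be the edges of F at u and D the others.  The new sets
    counted by z include {e, f} with f in K, {e, f, g} with f in K, g in D not
    adjacent to f, and {e} with an adjacent pair inside D
    (nearly_independent_countU1).  Without triangles, an edge of D meets at most
    one edge of K, so the second family has size at least (#|K| - 1) #|D|.  If D
    is not empty, i.e. if the new tree is not a star centred at u, this gives
      z(F + e) >= z(F) + m + (m - 4)
    (nearly_independent_count_grow).  Only few edges in K are delicate.  If K is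
    a single edge f, the adjacent pairs in D make up for the loss, because the
    line graph of a tree is connected and contains the clique formed by f and its
    neighbours (grown_tree_clique_bound).  If K has two edges, the elements of D
    that meet K fall into two cliques (leq_card_adjacent_pairs_image).

    A star that gains a leaf at its centre gains exactly m.  Hence a tree with M
    edges that stopped being a star when it had j of them satisfies
      z >= 'C(M, 2) + (j - 4) + ... + (M - 1 - 4).
    The worst start is j = 2, with terms -2, -1, 0, 1, ..., and the sum is
    positive for every j exactly when M >= 8, which is the hypothesis n >= 9.

    So equality forces every spanning tree grown in this way to be a star.  If
    the graph had a further edge xy off the centre c, then {xy, cx} would be one
    more set; therefore the graph itself is the star. *)

Set Implicit Arguments.
Unset Strict Implicit.
Unset Printing Implicit Defensive.

(** * Edge sets with one adjacent pair *)

Lemma set2_injr (T : finType) (e f g : T) : [set e; f] = [set e; g] -> f = g.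
Proof.
move=> H; have := set22 e f; rewrite H in_set2 => /orP[]/eqP // fe.
by have := set22 e g; rewrite -H in_set2 fe orbb => /eqP.
Qed.

Section OnePair.
Variable G : sgraph.
Implicit Types (e f g : {set G}) (A I F : {set {set G}}).

(** [Z1 G] is the case [F = edges G]; a free [F] lets one argue by adding edges. *)
Definition nearly_independent_count F : nat :=
  #|[set I : {set {set G}} | (I \subset F) && (#|adjacent_pairs I| == 1)]|.

Lemma adjacent_edgesC e f : adjacent_edges e f = adjacent_edges f e.
Proof. by rewrite /adjacent_edges eq_sym setIC. Qed.

Lemma adjacent_edgesxx e : adjacent_edges e e = false.
Proof. by rewrite /adjacent_edges eqxx. Qed.

Lemma adjacent_pairsP I p :
  reflect (exists e f, [/\ e \in I, f \in I, adjacent_edges e f & p = [set e; f]])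
          (p \in adjacent_pairs I).
Proof.
rewrite inE; apply: (iffP exists_inP).
  by case=> e eI /exists_inP[f fI /andP[ef /eqP->]]; exists e, f.
case=> e [f [eI fI ef ->]]; exists e => //; apply/exists_inP.
by exists f => //; rewrite ef eqxx.
Qed.

Lemma adjacent_pairsS A I : A \subset I -> adjacent_pairs A \subset adjacent_pairs I.
Proof.
move=> /subsetP AI; apply/subsetP => p /adjacent_pairsP[e [f [eA fA ef ->]]].
by apply/adjacent_pairsP; exists e, f; split; rewrite ?AI.
Qed.

Lemma adjacent_pairs_sub I p : p \in adjacent_pairs I -> p \subset I.
Proof.
by case/adjacent_pairsP=> e [f [eI fI _ ->]]; rewrite subUset !sub1set eI fI.
Qed.

Lemma card_adjacent_pairs1 I e f : e \in I -> f \in I -> adjacent_edges e f ->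
  (forall a b, a \in I -> b \in I -> adjacent_edges a b -> [set a; b] = [set e; f]) ->
  #|adjacent_pairs I| == 1.
Proof.
move=> eI fI ef H; suff -> : adjacent_pairs I = [set [set e; f]] by rewrite cards1.
apply/setP => p; rewrite in_set1; apply/adjacent_pairsP/eqP.
  by case=> a [b [aI bI ab ->]]; apply: H.
by move->; exists e, f.
Qed.

Lemma nearly_independent_countS A F : A \subset F ->
  nearly_independent_count A <= nearly_independent_count F.
Proof.
move=> AF; apply/subset_leq_card/subsetP => I; rewrite !inE => /andP[IA ->].
by rewrite (subset_trans IA AF).
Qed.

Lemma card_adjacent_pairsU1 A e : e \notin A ->
  #|adjacent_pairs (e |: A)| = #|adjacent_pairs A| + #|[set f in A | adjacent_edges e f]|.
Proof.
move=> eA; rewrite -(card_imset _ (@set2_injr _ e)) -cardsUI.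
have -> : adjacent_pairs A :&:
    [set [set e; f] | f in [set f in A | adjacent_edges e f]] = set0.
  apply/setP => p; rewrite !inE; apply/negP => /andP[pA /imsetP[f _ pE]].
  have /adjacent_pairs_sub/subsetP/(_ e) : p \in adjacent_pairs A by rewrite inE.
  by rewrite pE set21 => /(_ isT) e'; rewrite e' in eA.
rewrite cards0 addn0; congr #|pred_of_set _|; apply/setP => p; rewrite in_setU.
apply/idP/orP.
  case/adjacent_pairsP=> x [y [/setU1P[->|xA] /setU1P[->|yA] xy ->]].
  - by rewrite adjacent_edgesxx in xy.
  - by right; apply/imsetP; exists y; rewrite // inE yA.
  - right; apply/imsetP; exists x; first by rewrite inE xA adjacent_edgesC.
    by rewrite setUC.
  - by left; apply/adjacent_pairsP; exists x, y.
case=> [/(subsetP (adjacent_pairsS (subsetUr _ _))) //|/imsetP[f]].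
rewrite inE => /andP[fA ef] ->; apply/adjacent_pairsP.
by exists e, f; rewrite setU11 setU1r.
Qed.

Lemma card_adjacent_pairs_clique A :
  {in A &, forall e f, e != f -> adjacent_edges e f} ->
  #|adjacent_pairs A| = 'C(#|A|, 2).
Proof.
move=> cl; rewrite -cards_draws; congr #|pred_of_set _|; apply/setP => p.
rewrite [RHS]inE; apply/idP/andP.
  move=> pA; split; first exact: adjacent_pairs_sub pA.
  case/adjacent_pairsP: pA => e [f [_ _ ef ->]].
  by case/andP: ef => ef _; rewrite cards2 ef.
case=> pA /cards2P[e [f [ef pE]]]; rewrite pE in pA *.
move: pA; rewrite subUset !sub1set => /andP[eA fA].
by apply/adjacent_pairsP; exists e, f; rewrite cl.
Qed.

Lemma nearly_independent_count_clique A :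
  {in A &, forall e f, e != f -> adjacent_edges e f} ->
  nearly_independent_count A = 'C(#|A|, 2).
Proof.
move=> cl; rewrite -cards_draws; congr #|pred_of_set _|; apply/setP => I.
rewrite !inE; case: (boolP (I \subset A)) => //= /subsetP IA.
rewrite card_adjacent_pairs_clique; last by move=> e f /IA eA /IA; apply: cl.
case: #|I| => [|[|[|k]]] //.
by rewrite binS bin1; lia.
Qed.

(** If [h] colours [A] so that every colour class is a clique, each element
    beyond the first of its class brings an adjacent pair of its own. *)
Lemma leq_card_adjacent_pairs_image (T : finType) (h : {set G} -> T) A :
  {in A &, forall e f, e != f -> h e = h f -> adjacent_edges e f} ->
  #|A| <= #|adjacent_pairs A| + #|h @: A|.
Proof.
elim: {A}_.+1 {-2}A (ltnSn #|A|) => // m IH A leA cl.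
have [->|[e eA]] := set_0Vmem A; first by rewrite cards0.
rewrite -(setD1K eA); set B := A :\ e.
have eB : e \notin B by rewrite !inE eqxx.
have BA : B \subset A by apply: subsetDl.
rewrite card_adjacent_pairsU1 // cardsU1 eB.
have {IH} IH : #|B| <= #|adjacent_pairs B| + #|h @: B|.
  apply: IH; first by rewrite -(setD1K eA) cardsU1 eB in leA.
  by move=> x y /(subsetP BA) xA /(subsetP BA); apply: cl.
have arith a b c d x y : a <= b + c -> x <= d + y -> x + a <= b + d + (y + c) by lia.
rewrite imsetU1 cardsU1; apply: arith IH _.
have [/imsetP[f fB hE]|_] := boolP (h e \in _); last by rewrite leq_addl.
rewrite addn0; apply/card_gt0P; exists f.
have ef : e != f by apply: contraNneq eB => ->.
by rewrite inE fB cl // (subsetP BA).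
Qed.

(** The three families on the left are the nearly independent sets containing [e]
    that have two or three elements: [e] with a neighbour, [e] with a neighbour
    and an edge away from both, and [e] with an adjacent pair away from [e].
    Larger sets are discarded, as these already suffice. *)
Lemma nearly_independent_countU1 F e (K := [set f in F | adjacent_edges e f])
    (D := [set f in F | ~~ adjacent_edges e f]) : e \notin F ->
  nearly_independent_count F + #|K|
    + #|[set fg in setX K D | ~~ adjacent_edges fg.1 fg.2]| + #|adjacent_pairs D|
  <= nearly_independent_count (e |: F).
Proof.
move=> eF.
set N := [set fg in setX K D | _].
(* Each family is represented by its sets with [e] removed: these have size 1,
   size 2 and meet [K], or are contained in [D], so the families are disjoint. *)
pose A1 := [set [set f] | f in K].
pose A2 := [set [set fg.1; fg.2] | fg in N].
pose A3 := adjacent_pairs D.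
have KF : K \subset F by apply/subsetP => x; rewrite inE => /andP[].
have DF : D \subset F by apply/subsetP => x; rewrite inE => /andP[].
have KD x : x \in K -> x \in D -> false.
  by rewrite !inE => /andP[_ ->] /andP[].
have NP f g : (f, g) \in N -> [/\ f \in K, g \in D & adjacent_edges f g = false].
  by rewrite inE in_setX => /andP[/andP[fK gD] /negbTE].
have A1F p : p \in A1 -> p \subset F.
  by case/imsetP=> f fK ->; rewrite sub1set (subsetP KF).
have A2F p : p \in A2 -> p \subset F.
  case/imsetP=> -[f g] /NP[fK gD _] ->.
  by rewrite subUset !sub1set (subsetP KF) // (subsetP DF).
have A3F p : p \in A3 -> p \subset F.
  by move=> /adjacent_pairs_sub pD; apply: subset_trans DF.
have c1 : #|A1| = #|K| by apply/card_imset/set1_inj.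
have c2 : #|A2| = #|N|.
  apply: card_in_imset => -[f g] [f' g'] /NP[fK gD _] /NP[fK' gD' _] /= H.
  have ff : f = f'.
    have := set21 f g; rewrite H => /set2P[] // fg.
    by have := KD f fK; rewrite fg => /(_ gD').
  by rewrite ff in H *; rewrite (set2_injr H).
have d12 : A1 :&: A2 = set0.
  apply/setP => p; rewrite in_setI in_set0.
  apply/negP => /andP[/imsetP[f _ ->] /imsetP[[f' g'] /NP[fK' gD' _] /= H]].
  have := set21 f' g'; have := set22 f' g'; rewrite -H => /set1P gE /set1P fE.
  by have := KD f' fK'; rewrite fE -gE => /(_ gD').
have d123 : (A1 :|: A2) :&: A3 = set0.
  apply/setP => p; rewrite in_setI in_setU in_set0.
  apply/negP => /andP[pK /adjacent_pairs_sub/subsetP pD].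
  case/orP: pK pD => /imsetP[]; first by move=> f fK -> /(_ f (set11 _)) /(KD f fK).
  by move=> [f g] /NP[fK _ _] -> /(_ f (set21 _ _)) /(KD f fK).
have inj : {in A1 :|: A2 :|: A3 &, injective (fun p => e |: p)}.
  have ne p : p \in A1 :|: A2 :|: A3 -> e \notin p.
    rewrite !in_setU -orbA => pA; apply: contra eF; apply: subsetP.
    by case/or3P: pA; [apply: A1F|apply: A2F|apply: A3F].
  by move=> p q /ne pe /ne qe /= H; rewrite -(setU1K pe) H setU1K.
have cA : #|A1| + #|A2| + #|A3| = #|A1 :|: A2 :|: A3|.
  by rewrite !cardsU d123 d12 !cards0 !subn0.
rewrite -!addnA -c1 -c2 (addnA #|A1|) cA -(card_in_imset inj).
rewrite -[X in X <= _]cardsUI.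
set X := _ :&: _.
have -> : X = set0.
  apply/setP => p; rewrite !inE; apply/negP => /andP[/andP[/subsetP pF _] /imsetP[q _ pE]].
  by have := pF e; rewrite pE setU11 (negbTE eF) => /(_ isT).
rewrite cards0 addn0; apply/subset_leq_card/subsetP => I.
case/setUP.
  by rewrite !inE => /andP[IF ->]; rewrite andbT (subset_trans IF) ?subsetUr.
have one (q : {set {set G}}) : q \subset F -> #|adjacent_pairs (e |: q)| == 1 ->
    e |: q \in [set I : {set {set G}} | (I \subset e |: F) && (#|adjacent_pairs I| == 1)].
  by move=> qF one; rewrite inE one setUS.
have Ke f : f \in K -> adjacent_edges e f by rewrite inE => /andP[].
have De f : f \in D -> adjacent_edges e f = false by rewrite inE => /andP[_ /negbTE].
case/imsetP=> q; rewrite !in_setU -orbA => /or3P[qA|qA|qA] ->.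
- apply: one (A1F _ qA) _; case/imsetP: qA => f /Ke ef ->.
  apply: (card_adjacent_pairs1 (e := e) (f := f)); rewrite ?setU11 ?in_setU ?set11 ?orbT //.
  by move=> a b /set2P[]-> /set2P[]->; rewrite ?adjacent_edgesxx // setUC.
- apply: one (A2F _ qA) _; case/imsetP: qA => -[f g] /NP[/Ke ef /De eg fg] ->.
  apply: (card_adjacent_pairs1 (e := e) (f := f)); rewrite ?in_setU ?set11 ?orbT //.
  move=> a b /setU1P[->|/set2P[]->] /setU1P[->|/set2P[]->] //=;
    rewrite ?adjacent_edgesxx // ?eg ?fg // ?(adjacent_edgesC g) ?eg ?fg //.
  by rewrite setUC.
- apply: one (A3F _ qA) _; case/adjacent_pairsP: qA => f [g [/De ef /De eg fg ->]].
  apply: (card_adjacent_pairs1 (e := f) (f := g)); rewrite ?in_setU ?set11 ?orbT //.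
  move=> a b /setU1P[->|/set2P[]->] /setU1P[->|/set2P[]->] //=;
    rewrite ?adjacent_edgesxx // ?eg ?ef // ?(adjacent_edgesC _ e) ?eg ?ef //.
  by rewrite setUC.
Qed.
End OnePair.

(** * Arithmetic of the increments *)

Lemma three_mul_le_bin n : 3 * n <= 'C(n.+1, 2) + 3.
Proof.
elim: n => // n IH; rewrite binS bin1.
have [|n2] := ltnP n 2; first by case: n {IH} => [|[]].
by lia.
Qed.

(** Here [k] and [d] are the numbers of edges at and away from the attaching
    vertex, [d1] counts the edges away from it that meet one at it, [n] the
    non-adjacent pairs between the two kinds, and [p] the adjacent pairs among
    the edges away from it. *)
Lemma growth_arith k d n d1 p m x y :
  k + d = m -> 0 < k -> 0 < d -> k * d <= n + d1 -> d1 <= d -> d1 <= p + k ->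
  (k = 1 -> 'C(d1.+1, 2) + m <= p + d1 + d1.+1) ->
  x + k + n + p <= y -> x + 2 * m <= y + 4.
Proof.
move=> <- k0 d0 nd dd pk H1 xy; case: k k0 => [|[|[|k]]] // _ in nd pk H1 xy *.
- by have := H1 erefl; have := three_mul_le_bin d1; lia.
- by lia.
- by nia.
Qed.

Lemma bin_step_arith a b c k :
  'C(a, 2) + b <= c + a -> a <= k -> 'C(a.+1, 2) + b.+1 <= c + k + a.+1.
Proof. by rewrite binS bin1; lia. Qed.

Lemma leave_star_arith m x y :
  'C(m, 2) <= x -> x + 2 * m <= y + 4 -> 1 < m ->
  2 * 'C(m.+1, 2) <= y + 4 * (m.+1 - m) + 'C(m, 2).
Proof. by rewrite binS bin1; lia. Qed.

Lemma stay_nonstar_arith j m x y : j < m ->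
  2 * 'C(m, 2) <= x + 4 * (m - j) + 'C(j, 2) -> x + 2 * m <= y + 4 ->
  2 * 'C(m.+1, 2) <= y + 4 * (m.+1 - j) + 'C(j, 2).
Proof. by rewrite binS bin1; lia. Qed.

(** After doubling, the claim is [8 * (m - j) < (m - j) * (m + j - 1)], that is
    [9 < m + j]; the extreme case [m = 8], [j = 2] is just large enough. *)
Lemma nonstar_final_arith j m x : 1 < j < m -> 8 <= m ->
  2 * 'C(m, 2) <= x + 4 * (m - j) + 'C(j, 2) -> 'C(m, 2) < x.
Proof.
have b2 k : 2 * 'C(k, 2) = k * k.-1 by elim: k => // k IH; rewrite binS bin1; nia.
by have := b2 j; have := b2 m; nia.
Qed.

(** * Trees grown leaf by leaf *)

Section Trees.
Variable G : sgraph.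
Implicit Types (e f g : {set G}) (F Q : {set {set G}}) (S : {set G}).

Lemma adjacent_edges_common (c : G) e f :
  c \in e -> c \in f -> e != f -> adjacent_edges e f.
Proof.
move=> ce cf ef; rewrite /adjacent_edges ef; apply/set0Pn.
by exists c; rewrite inE ce.
Qed.

(** Trees of [G], as vertex set and edge set; building them by leaf additions
    provides the induction on which all counts below rest. *)
Inductive grown_tree : {set G} -> {set {set G}} -> Prop :=
| grown_tree1 v : grown_tree [set v] set0
| grown_treeU S F u v : grown_tree S F -> u \in S -> v \notin S -> adj u v ->
    grown_tree (v |: S) ([set u; v] |: F).

Lemma grown_tree_edge S F e : grown_tree S F -> e \in F ->
  exists x y, [/\ x \in S, y \in S, adj x y & e = [set x; y]].
Proof.
elim=> [v|{}S {}F u v _ IH uS vS uv]; first by rewrite inE.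
case/setU1P=> [->|/IH[x [y [xS yS xy ->]]]]; last first.
  by exists x, y; rewrite !in_setU xS yS !orbT.
by exists u, v; rewrite !in_setU uS set11 orbT.
Qed.

Lemma grown_tree_edges S F : grown_tree S F -> F \subset edges G.
Proof.
move=> tF; apply/subsetP => e /(grown_tree_edge tF)[x [y [_ _ xy ->]]].
by rewrite inE; apply/existsP; exists x; apply/existsP; exists y; rewrite xy eqxx.
Qed.

Lemma grown_tree_edge_sub S F e : grown_tree S F -> e \in F -> e \subset S.
Proof.
move=> tF /(grown_tree_edge tF)[x [y [xS yS _ ->]]].
by rewrite subUset !sub1set xS yS.
Qed.

Lemma grown_tree_edge_other S F e u : grown_tree S F -> e \in F -> u \in e ->
  exists w, [/\ adj u w & e = [set u; w]].
Proof.
move=> tF /(grown_tree_edge tF)[x [y [_ _ xy ->]]] /set2P[]->.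
  by exists y.
by exists x; rewrite adj_sym xy setUC.
Qed.

Lemma new_edge_notin_grown_tree S F u v : grown_tree S F -> v \notin S ->
  [set u; v] \notin F.
Proof.
move=> tF; apply: contra => /(grown_tree_edge_sub tF)/subsetP; apply.
exact: set22.
Qed.

Lemma card_grown_tree S F : grown_tree S F -> #|S| = #|F|.+1.
Proof.
elim=> [v|{}S {}F u v tF IH uS vS uv]; first by rewrite cards1 cards0.
by rewrite !cardsU1 vS (new_edge_notin_grown_tree _ tF) // IH.
Qed.

Lemma grown_tree_cover S F x : grown_tree S F -> x \in S -> F != set0 ->
  exists2 e, e \in F & x \in e.
Proof.
elim=> [v|{}S {}F u v tF IH uS vS uv]; first by rewrite eqxx.
case/setU1P=> [->|xS] _; first by exists [set u; v]; rewrite ?setU11 ?set22.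
have [F0|/(IH xS)[e eF xe]] := eqVneq F set0; last by exists e; rewrite // setU1r.
have := card_grown_tree tF; rewrite F0 cards0 => /eqP/cards1P[y Sy].
move: uS xS; rewrite Sy !inE => /eqP-> /eqP->.
by exists [set y; v]; rewrite ?set21 // setU11.
Qed.

Lemma grown_tree_triangle_free S F x y z : grown_tree S F ->
  [set x; y] \in F -> [set y; z] \in F -> [set x; z] \in F -> False.
Proof.
move=> tF; elim: tF x y z => [v x y z|{}S {}F u v tF IH uS vS uv]; first by rewrite inE.
have inj a b c : [set a; b] = [set u; v] -> [set a; c] = [set u; v] -> b = c.
  by move=> <- /esym; apply: set2_injr.
have loop a : [set a; a] \in [set u; v] |: F -> False.
  rewrite setUid => /setU1P[/setP H|/(grown_tree_edge tF)[x [y [_ _ xy /setP H]]]].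
    have := H u; have := H v; rewrite set21 set22 !in_set1 => /eqP vE /eqP uE.
    by rewrite uE vE adj_irrefl in uv.
  have := H x; have := H y; rewrite set21 set22 !in_set1 => /eqP yE /eqP xE.
  by rewrite xE yE adj_irrefl in xy.
have old a b : a = v -> [set a; b] \in [set u; v] |: F -> [set a; b] = [set u; v].
  by move=> -> /setU1P[//|]; rewrite setUC (negbTE (new_edge_notin_grown_tree _ tF vS)).
(* A triangle through the new vertex would use the new edge twice. *)
have key a b c : a = v -> [set a; b] \in [set u; v] |: F ->
    [set a; c] \in [set u; v] |: F -> [set b; c] \in [set u; v] |: F -> False.
  move=> av /(old _ _ av) ab /(old _ _ av) ac.
  by rewrite (inj _ _ _ ab ac) => /loop.
move=> x y z xy yz xz.
have [/eqP xv|nx] := boolP (x == v); first exact: key xv xy xz yz.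
have [/eqP yv|ny] := boolP (y == v).
  by apply: key yv _ yz xz; rewrite setUC.
have [/eqP zv|nz] := boolP (z == v).
  by apply: key zv _ _ xy; rewrite setUC.
have oldF a b : a != v -> b != v -> [set a; b] \in [set u; v] |: F -> [set a; b] \in F.
  move=> av bv /setU1P[/setP/(_ v)|//].
  by rewrite !inE eqxx orbT eq_sym (negbTE av) eq_sym (negbTE bv).
by apply: (IH x y z); apply: oldF.
Qed.

Section Growth.
Variables (S : {set G}) (F : {set {set G}}) (u v : G).
Hypotheses (tF : grown_tree S F) (uS : u \in S) (vS : v \notin S).

Lemma adjacent_new_edge f : f \in F -> adjacent_edges [set u; v] f = (u \in f).
Proof.
move=> fF; have vf : v \notin f.
  by apply: contra vS; apply/subsetP/(grown_tree_edge_sub tF).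
apply/idP/idP => [/andP[_ /set0Pn[x]]|uf].
  by rewrite inE => /andP[/set2P[]-> //]; rewrite (negbTE vf).
apply: (@adjacent_edges_common u); rewrite ?set21 //.
by apply: contraNneq vf => <-; rewrite set22.
Qed.

Lemma card_new_edge_neighbours_gt0 : F != set0 ->
  0 < #|[set f in F | adjacent_edges [set u; v] f]|.
Proof.
move=> /(grown_tree_cover tF uS)[f fF uf]; apply/card_gt0P; exists f.
by rewrite inE fF adjacent_new_edge.
Qed.
End Growth.

(** The line graph of a tree is connected: starting from the clique [Q] and its
    ['C(#|Q|, 2)] adjacent pairs, every edge outside [Q] must add at least one.
    The induction removes the last leaf edge instead, whose neighbours include
    the rest of [Q] if it belongs to [Q]. *)
Lemma grown_tree_clique_bound S F Q : grown_tree S F -> Q \subset F -> Q != set0 ->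
  {in Q &, forall e f, e != f -> adjacent_edges e f} ->
  'C(#|Q|, 2) + #|F| <= #|adjacent_pairs F| + #|Q|.
Proof.
move=> tF; elim: tF Q => [v|{}S {}F u v tF IH uS vS uv] Q QF Q0 cl.
  by move: Q0; rewrite subset0 in QF; rewrite QF.
set e := [set u; v] in QF *.
have eF : e \notin F by exact: new_edge_notin_grown_tree tF vS.
rewrite card_adjacent_pairsU1 // cardsU1 eF.
have K0 : F != set0 -> _ := card_new_edge_neighbours_gt0 tF uS vS.
have [eQ|eQ] := boolP (e \in Q); last first.
  have QF' : Q \subset F by rewrite -(setU1K eF) subsetD1 QF eQ.
  have F0 : F != set0.
    by apply: contraNneq Q0 => F0; rewrite F0 subset0 in QF'.
  have arith a b c d k : 0 < k -> a + b <= c + d -> a + (1 + b) <= c + k + d by lia.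
  exact: arith (K0 F0) (IH _ QF' Q0 cl).
set Q' := Q :\ e.
have eQ' : e \notin Q' by rewrite !inE eqxx.
have QE : Q = e |: Q' by rewrite setD1K.
have Q'F : Q' \subset F by rewrite subDset.
have Q'K : Q' \subset [set f in F | adjacent_edges e f].
  apply/subsetP => f fQ'; rewrite inE (subsetP Q'F) //=.
  by apply: cl => //; [rewrite QE setU1r | apply: contraNneq eQ' => ->].
rewrite QE cardsU1 eQ'.
have [Q'0|Q'0] := eqVneq Q' set0; last first.
  have cl' : {in Q' &, forall e f, e != f -> adjacent_edges e f}.
    by move=> f g fQ gQ; apply: cl; rewrite QE setU1r.
  exact: bin_step_arith (IH _ Q'F Q'0 cl') (subset_leq_card Q'K).
rewrite Q'0 cards0.
have [F0|F0] := eqVneq F set0; first by rewrite F0 cards0 leq_addl.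
have [f fF uf] := grown_tree_cover tF uS F0.
have arith b c k : 0 < k -> 'C(1, 2) + b <= c + 1 ->
    'C(1 + 0, 2) + (1 + b) <= c + k + (1 + 0).
  by rewrite !bin_small //; lia.
have := IH [set f]; rewrite cards1 sub1set => /(_ fF) IHf; apply: arith (K0 F0) (IHf _ _).
  by apply/set0Pn; exists f; rewrite set11.
by move=> x y /set1P-> /set1P->; rewrite eqxx.
Qed.

(** A new leaf edge that leaves some edge [g] untouched gains at least
    [2 * #|F| - 4] sets: [#|F|] as in a star, and an excess of [#|F| - 4],
    which is negative only for small trees. *)
Lemma nearly_independent_count_grow S F u v g : grown_tree S F -> u \in S -> v \notin S ->
  adj u v -> g \in F -> u \notin g ->
  nearly_independent_count F + 2 * #|F|
    <= nearly_independent_count ([set u; v] |: F) + 4.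
Proof.
move=> tF uS vS uv gF ug; set e := [set u; v].
have eF : e \notin F by exact: new_edge_notin_grown_tree tF vS.
have F0 : F != set0 by apply/set0Pn; exists g.
have K0 : 0 < _ := card_new_edge_neighbours_gt0 tF uS vS F0.
have := nearly_independent_countU1 eF.
set K := [set f in F | adjacent_edges e f] in K0 *.
set D := [set f in F | ~~ adjacent_edges e f].
set N := [set fg in setX K D | _].
pose D1 := [set g in D | [exists f in K, adjacent_edges f g]].
have inK f : (f \in K) = (f \in F) && (u \in f).
  by rewrite inE; case: (boolP (f \in F)) => //= fF; rewrite (adjacent_new_edge u tF).
have inD f : (f \in D) = (f \in F) && (u \notin f).
  by rewrite inE; case: (boolP (f \in F)) => //= fF; rewrite (adjacent_new_edge u tF).
have D1D : D1 \subset D by apply/subsetP => x; rewrite inE => /andP[].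
have FE : F = K :|: D.
  by apply/setP => f; rewrite in_setU inK inD; case: (f \in F); case: (u \in f).
have KD : K :&: D = set0.
  apply/setP => f; rewrite in_setI inK inD in_set0.
  by case: (f \in F); case: (u \in f).
have mE : #|K| + #|D| = #|F| by rewrite FE cardsU KD cards0 subn0.
have other f : f \in K -> exists w, f = [set u; w] /\
    forall h, h \in D -> adjacent_edges f h -> w \in h.
  rewrite inK => /andP[fF uf].
  have [w [_ fE]] := grown_tree_edge_other tF fF uf.
  exists w; split=> // h; rewrite inD => /andP[_ uh] /andP[_ /set0Pn[x]].
  by rewrite inE fE => /andP[/set2P[]-> //]; rewrite (negbTE uh).
(* An edge of [D] meeting two edges of [K] would close a triangle. *)
have uniqK f f' h : f \in K -> f' \in K -> h \in D ->
    adjacent_edges f h -> adjacent_edges f' h -> f = f'.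
  move=> fK f'K hD fh f'h.
  have [w [fE /(_ h hD fh) wh]] := other f fK.
  have [w' [f'E /(_ h hD f'h) w'h]] := other f' f'K.
  have [ww|ww] := eqVneq w w'; first by rewrite fE f'E ww.
  move: fK f'K hD; rewrite !inK inD => /andP[fF _] /andP[f'F _] /andP[hF _].
  have [x [_ hE]] := grown_tree_edge_other tF hF wh.
  case: (@grown_tree_triangle_free S F u w w' tF); rewrite -?fE -?f'E //.
  by move: w'h; rewrite hE => /set2P[/eqP|->]; rewrite -?hE // eq_sym (negbTE ww).
have D0 : 0 < #|D| by apply/card_gt0P; exists g; rewrite inD gF.
have nD : #|K| * #|D| <= #|N| + #|D1|.
  pose M := [set fg in setX K D | adjacent_edges fg.1 fg.2].
  have MP f h : (f, h) \in M -> [/\ f \in K, h \in D & adjacent_edges f h].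
    by rewrite inE in_setX => /andP[/andP[]].
  have cM : #|snd @: M| = #|M|.
    apply: card_in_imset => -[f h] [f' h'] /MP[fK hD fh] /MP[f'K h'D f'h'] /= hh.
    by rewrite -hh in f'h' *; rewrite (uniqK f f' h).
  have MD1 : snd @: M \subset D1.
    apply/subsetP => _ /imsetP[[f h] /MP[fK hD fh] ->] /=.
    by rewrite inE hD; apply/exists_inP; exists f.
  have XNM : setX K D \subset N :|: M.
    by apply/subsetP => x xX;
      rewrite in_setU [x \in N]in_set [x \in M]in_set xX /=; case: adjacent_edges.
  rewrite -cardsX (leq_trans (subset_leq_card XNM)) //.
  by rewrite (leq_trans (leq_card_setU _ _)) // leq_add2l -cM subset_leq_card.
(* Colour each edge of [D1] by the edge of [K] it meets; a colour class shares
   the far end of that edge.  The default [set0] is never reached on [D1]. *)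
pose h g := odflt set0 [pick f in K | adjacent_edges f g].
have hP f : f \in D1 -> (h f \in K) && adjacent_edges (h f) f.
  rewrite inE => /andP[_ /exists_inP[f' f'K f'f]]; rewrite /h.
  by case: pickP => [//|/(_ f')]; rewrite f'K f'f.
have pK : #|D1| <= #|adjacent_pairs D| + #|K|.
  apply: leq_trans (leq_card_adjacent_pairs_image (h := h) _) _.
    move=> x y xD yD xy hxy; have /andP[hK hx] := hP x xD; have /andP[_ hy] := hP y yD.
    have [w [_ ww]] := other _ hK; apply: (@adjacent_edges_common w) => //.
      by apply: ww => //; apply: (subsetP D1D).
    by apply: ww; rewrite ?hxy // (subsetP D1D).
  apply: leq_add; first exact/subset_leq_card/adjacent_pairsS.
  by apply/subset_leq_card/subsetP => _ /imsetP[x /hP/andP[hK _] ->].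
(* With [K] reduced to [f], the clique is [f] and its neighbours, all through the
   far end of [f]; connectedness then bounds the pairs inside [D] from below. *)
have one : #|K| = 1 -> 'C(#|D1|.+1, 2) + #|F| <= #|adjacent_pairs D| + #|D1| + #|D1|.+1.
  move=> /eqP/cards1P[f KE].
  have fK : f \in K by rewrite KE set11.
  have fD : f \notin D by apply/negP => fD; have := in_set0 f; rewrite -KD inE fK fD.
  have fD1 : f \notin D1 by apply: contra fD; apply: (subsetP D1D).
  have D1f x : x \in D1 -> adjacent_edges f x.
    by move=> /hP/andP[]; rewrite KE => /set1P->.
  have [w [fE ww]] := other f fK.
  have cl : {in f |: D1 &, forall x y, x != y -> adjacent_edges x y}.
    have wD x : x \in f |: D1 -> w \in x.
      case/setU1P=> [->|xD]; first by rewrite fE set22.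
      by apply: ww (D1f x xD); apply: (subsetP D1D).
    by move=> x y /wD wx /wD wy; apply: adjacent_edges_common wx wy.
  have QF : f |: D1 \subset F.
    by rewrite FE KE setUS.
  have Q0 : f |: D1 != set0 by apply/set0Pn; exists f; rewrite setU11.
  have := grown_tree_clique_bound tF QF Q0 cl.
  rewrite cardsU1 fD1 => /leq_trans; apply; rewrite leq_add2r.
  rewrite [in X in X <= _]FE KE card_adjacent_pairsU1 // leq_add2l.
  apply/subset_leq_card/subsetP => x; rewrite !inE => /andP[-> fx] /=.
  by apply/exists_inP; exists f.
exact: growth_arith mE K0 D0 nD (subset_leq_card D1D) pK one.
Qed.
End Trees.

(** * Stars and the comparison *)

Section Stars.
Variable G : sgraph.
Implicit Types (e f g : {set G}) (F Q : {set {set G}}) (S : {set G}) (c : G).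

Lemma nearly_independent_count_star c F : {in F, forall e, c \in e} ->
  nearly_independent_count F = 'C(#|F|, 2).
Proof.
move=> cF; apply: nearly_independent_count_clique => e f eF fF.
by apply: (@adjacent_edges_common _ c); apply: cF.
Qed.

(** The number [j] is the size at which the growing tree stopped being a star.
    The inequality is [z >= 'C(M, 2) + (j - 4) + ... + (M - 1 - 4)] for
    [M = #|F|], rearranged to avoid subtraction: the sum of the excesses is
    ['C(M, 2) - 'C(j, 2) - 4 * (M - j)]. *)
Lemma grown_tree_star_or_large S F : grown_tree S F ->
  (exists c, {in F, forall e, c \in e}) \/
  (exists2 j, 1 < j < #|F| &
     2 * 'C(#|F|, 2) <= nearly_independent_count F + 4 * (#|F| - j) + 'C(j, 2)).
Proof.
elim=> [v|{}S {}F u v tF IH uS vS uv]; first by left; exists v => e; rewrite inE.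
have eF : [set u; v] \notin F by exact: new_edge_notin_grown_tree tF vS.
have [/forall_inP uF|] := boolP [forall f in F, u \in f].
  by left; exists u => f /setU1P[->|/uF]; rewrite ?set21.
rewrite negb_forall_in => /exists_inP[g gF ug].
have step := nearly_independent_count_grow tF uS vS uv gF ug.
right; rewrite cardsU1 eF add1n; case: IH => [[c cF]|[j /andP[j1 jm] IH]]; last first.
  by exists j; [lia | apply: stay_nonstar_arith jm IH step].
(* Some edge contains [u] and [g] does not, so a tree that stops being a star
   has at least two edges. *)
have m2 : 1 < #|F|.
  have F0 : F != set0 by apply/set0Pn; exists g.
  have [f fF uf] := grown_tree_cover tF uS F0.
  have fg : f != g by apply: contraNneq ug => <-.
  have := @subset_leq_card _ [set f; g] F; rewrite cards2 fg; apply.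
  by rewrite subUset !sub1set fF gF.
exists #|F|; first by rewrite m2 /=.
by apply: leave_star_arith step m2; rewrite (nearly_independent_count_star cF).
Qed.

(** A tree that does not yet span extends: otherwise its vertex set would be
    closed under adjacency, against connectedness. *)
Lemma connected_grown_tree k : connected G -> 0 < k <= #|G| ->
  exists S F, grown_tree S F /\ #|S| = k.
Proof.
move=> cG; elim: k => // -[_ /card_gt0P[v _]|k IH kG].
  by exists [set v], set0; split; [apply: grown_tree1 | rewrite cards1].
have [|S [F [tF cS]]] := IH; first by lia.
have [u uS] : exists u, u \in S by apply/set0Pn; rewrite -cards_eq0 cS.
have [w wS] : exists w, w \notin S.
  apply/existsP; rewrite -negb_forall; apply/negP => /forallP allS.
  have : #|G| <= #|S| by apply/subset_leq_card/subsetP => x _.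
  by rewrite cS; lia.
have [/exists_inP[x xS /exists_inP[y yS xy]]|] :=
    boolP [exists x in S, exists y in ~: S, adj x y].
  rewrite inE in yS; exists (y |: S), ([set x; y] |: F).
  by split; [apply: grown_treeU | rewrite cardsU1 yS cS].
rewrite negb_exists_in => /forall_inP H.
have clS : closed adj (mem S).
  apply: intro_closed => [|x y xy xS]; first exact/sym_connect_sym/adj_sym.
  apply: contraNT (H x xS) => yS; apply/exists_inP; exists y; rewrite ?inE //.
by have := closed_connect clS (cG u w); rewrite uS (negbTE wS).
Qed.

(** Being a star with centre [c], expressed inside the graph: unlike isomorphism
    with a model it can be used to count edges directly. *)
Definition star_centre c := forall x y : G,
  adj x y = (x != y) && ((x == c) || (y == c)).

Lemma star_centre_edges c : star_centre c ->
  edges G = [set [set c; x] | x in ~: [set c]].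
Proof.
move=> Gc; apply/setP => e; rewrite inE; apply/existsP/imsetP.
  case=> x /existsP[y /andP[xy /eqP->]]; move: xy; rewrite Gc => /andP[xy].
  case/orP=> /eqP E; [exists y | exists x]; rewrite ?inE ?E //.
  - by rewrite -E eq_sym.
  - by rewrite -E.
  - by rewrite setUC.
case=> x; rewrite !inE => xc ->; exists c; apply/existsP; exists x.
by rewrite Gc eq_sym xc !eqxx.
Qed.

Lemma Z1_star_centre c : star_centre c -> Z1 G = 'C(#|G|.-1, 2).
Proof.
move=> Gc; rewrite /Z1 -/(nearly_independent_count (edges G)).
rewrite (@nearly_independent_count_star c) (star_centre_edges Gc).
  rewrite card_imset; last exact: set2_injr.
  by have := cardsC1 c; rewrite cardT -cardE => ->.
by move=> _ /imsetP[x _ ->]; rewrite set21.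
Qed.

(** Either a spanning tree is already too rich, or it is a star with centre [c];
    in that case one edge [xy] off the centre gives the additional set
    [{xy, cx}], and without such an edge the graph is the star. *)
Lemma Z1_connected_bound : 9 <= #|G| -> connected G ->
  (exists c, star_centre c) \/ 'C(#|G|.-1, 2) < Z1 G.
Proof.
move=> G9 cG.
have [|S [F [tF cS]]] := @connected_grown_tree #|G| cG; first by lia.
have cF : #|F| = #|G|.-1 by rewrite -cS (card_grown_tree tF).
have ST x : x \in S.
  by rewrite (eqP (_ : S == setT)) ?inE // eqEcard subsetT cardsT cS leqnn.
have FG := grown_tree_edges tF.
have F0 : F != set0 by rewrite -cards_eq0 cF; lia.
have zF := nearly_independent_countS FG.
case: (grown_tree_star_or_large tF) => [[c cinF]|[j j1 H]]; last first.
  right; apply: leq_trans zF; rewrite -cF; apply: nonstar_final_arith j1 _ H.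
  by rewrite cF; lia.
have cadj x : x != c -> adj c x.
  move=> xc; have [e eF xe] := grown_tree_cover tF (ST x) F0.
  have [w [cw eE]] := grown_tree_edge_other tF eF (cinF e eF).
  by move: xe; rewrite eE => /set2P[/eqP|-> //]; rewrite (negbTE xc).
have [/existsP[x /existsP[y /and3P[xy xc yc]]]|] :=
  boolP [exists x, exists y, [&& adj x y, x != c & y != c]].
  right; set I := [set [set x; y]; [set c; x]].
  have xyF : [set x; y] \notin F.
    by apply/negP => /cinF; rewrite !inE eq_sym (negbTE xc) eq_sym (negbTE yc).
  have IG : I \subset edges G.
    rewrite subUset !sub1set !inE; apply/andP; split; apply/existsP.
      by exists x; apply/existsP; exists y; rewrite xy eqxx.
    by exists c; apply/existsP; exists x; rewrite cadj // eqxx.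
  rewrite -cF -(nearly_independent_count_star cinF); apply/proper_card/properP; split.
    by apply/subsetP => J; rewrite !inE => /andP[JF];
      rewrite /nearly_independent1 (subset_trans JF).
  exists I; last first.
    by rewrite inE subUset !sub1set (negbTE xyF).
  rewrite inE /nearly_independent1 IG /=.
  have xye : adjacent_edges [set x; y] [set c; x].
    apply: (@adjacent_edges_common _ x); rewrite ?set21 ?set22 //.
    apply/negP => /eqP/setP/(_ c); rewrite !inE eqxx /=.
    by rewrite eq_sym (negbTE xc) eq_sym (negbTE yc).
  apply: (card_adjacent_pairs1 (e := [set x; y]) (f := [set c; x]));
    rewrite ?set21 ?set22 //.
  by move=> a b /set2P[]-> /set2P[]->;
    rewrite ?adjacent_edgesxx // => _; rewrite [LHS]setUC.
rewrite negb_exists => /forallP noE; left; exists c => x y.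
have [->|xy] := eqVneq x y; first by rewrite adj_irrefl.
have [xc|xc] /= := eqVneq x c; first by rewrite xc cadj // -xc eq_sym.
have [yc|yc] /= := eqVneq y c; first by rewrite yc adj_sym cadj.
by apply: contraNF (noE x) => xy'; apply/existsP; exists y; rewrite xy' xc yc.
Qed.
End Stars.

Lemma star_centre_star n : star_centre (inl ord0 : star n).
Proof.
case=> [i|i] [j|j]; rewrite /= /biadj /= ?ord1 ?eqxx //.
by rewrite andbF.
Qed.

Lemma card_star n : 0 < n -> #|star n| = n.
Proof. by case: n => // n _; rewrite /= card_sum !card_ord. Qed.

Lemma star_centre_isomorphic (G H : sgraph) (c : G) (d : H) :
  star_centre c -> star_centre d -> #|G| = #|H| -> isomorphic G H.
Proof.
move=> Gc Hd GH.
pose g (x : G) : H := enum_val (cast_ord GH (enum_rank x)).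
(* Any bijection becomes an isomorphism once it is corrected to send centre to
   centre. *)
pose f x := tperm (g c) d (g x).
have fi : injective f.
  by move=> x y /perm_inj/enum_val_inj/cast_ord_inj/enum_rank_inj.
have fb : bijective f by apply: inj_card_bij fi _; rewrite GH.
exists f => // x y; rewrite Gc Hd.
have fc : f c = d by rewrite /f /= tpermL.
by rewrite -fc !(inj_eq fi).
Qed.

Lemma isomorphic_star_centre (G H : sgraph) (d : H) :
  star_centre d -> isomorphic G H -> exists c : G, star_centre c.
Proof.
move=> Hd [f fb fadj]; have [h fh hf] := fb; exists (h d) => x y.
by rewrite -fadj Hd -[d in LHS]hf !(inj_eq (bij_inj fb)).
Qed.

Theorem theorem3 (n : nat) (T : sgraph) :
  9 <= n -> #|T| = n -> connected T ->
  Z1 (star n) <= Z1 T /\ (Z1 T = Z1 (star n) <-> isomorphic T (star n)).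
Proof.
move=> n9 Tn cT.
have Sn : #|star n| = n by apply: card_star; lia.
have Zs : Z1 (star n) = 'C(n.-1, 2) by rewrite (Z1_star_centre (@star_centre_star n)) Sn.
have iso c : @star_centre T c -> isomorphic T (star n).
  by move=> Tc; apply: star_centre_isomorphic Tc (@star_centre_star n) _; rewrite Sn.
have Zc c : @star_centre T c -> Z1 T = Z1 (star n).
  by move=> Tc; rewrite Zs (Z1_star_centre Tc) Tn.
have isoZ : isomorphic T (star n) -> Z1 T = Z1 (star n).
  by case/(isomorphic_star_centre (@star_centre_star n)) => c /Zc.
rewrite -Tn in n9; case: (Z1_connected_bound n9 cT) => [[c Tc]|].
  by rewrite (Zc c Tc); split=> //; split=> // _; apply: iso Tc.
rewrite Tn -Zs => lt; split; first exact: ltnW.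
by split=> // E; rewrite E ltnn in lt.
Qed.
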